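(* $\operatorname{Ext}^2_U(k,S)$ is generated as a $Z$-module by the classes of the 2-cocycles $R_e,R_f,R_h,T$ (listed in the context), subject to the single relation $$e^p R_e + f^p R_f - h^p R_h = c^{(p-1)/2} T$$ between their classes (that is, the kernel of the surjection from the free $Z$-module on four generators onto $\operatorname{Ext}^2_U(k,S)$ is generated as a $Z$-module by the element corresponding to this relation).
   Context: $k$ is a field of characteristic $p>2$; $\mathfrak{g}=\mathfrak{sl}_2(k)$ with standard basis $e,h,f$ ($[h,e]=2e$, $[h,f]=-2f$, $[e,f]=h$); $U=U(\mathfrak g)$; $k$ is the trivial $U$-module. $S=\bigoplus_{n\ge 0}S^n$ is the symmetric algebra on the adjoint $\mathfrak g$-module, with $\mathfrak g$ acting by derivations. Let $c=h^2+4ef\in S^{\mathfrak g}$, and let $Z$ be the subalgebra of $S$ generated by $c,e^p,h^p,f^p$ (so $Z=S^{\mathfrak g}$). Multiplication by elements of $Z$ is $\mathfrak g$-linear on $S$, making $\operatorname{Ext}^*_U(k,S)$ a $Z$-module. $\operatorname{Ext}^2_U(k,S)$ is computed from the standard (Chevalley–Eilenberg) resolution: it is the space of 2-cocycles, i.e. linear maps $\alpha:\wedge^2\mathfrak g\to S$ with $e\cdot\alpha(h\wedge f)+f\cdot\alpha(e\wedge h)=h\cdot\alpha(e\wedge f)$, modulo the 2-coboundaries, i.e. the maps $x\wedge y\mapsto x\cdot\beta(y)-y\cdot\beta(x)-\beta([x,y])$ for linear $\beta:\mathfrak g\to S$. A linear map $\alpha:\wedge^2\mathfrak g\to S$ is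 written as the triple $(\alpha(e\wedge h),\alpha(e\wedge f),\alpha(h\wedge f))$. The cocycles are $$R_e=(f^{p-1},0,0),\quad R_h=(eh^{p-2},0,fh^{p-2}),\quad R_f=(0,0,e^{p-1}),\quad T=(eh^{p-1},0,fh^{p-1}).$$ *)

(* Defs.v *)
From HB Require Import structures.
From mathcomp Require Import all_boot all_order all_algebra.
From mathcomp Require Import boolp.
From mathcomp Require Import generic_quotient ring_quotient.
From mathcomp Require Import mpoly ring.

Set Implicit Arguments.
Unset Strict Implicit.
Unset Printing Implicit Defensive.

Import GRing.Theory.
Local Open Scope ring_scope.
Local Open Scope quotient_scope.

Section Sl2.

Variable k : fieldType.

Definition traceless : {pred 'M[k]_2} := fun A => \tr A == 0.

Lemma traceless_submod_closed : submod_closed traceless.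
Proof.
split=> [|a A B /eqP trA /eqP trB].
  by rewrite /in_mem /= /traceless mxtrace0.
by rewrite /in_mem /= /traceless linearP /= trA trB mulr0 addr0.
Qed.

HB.instance Definition _ :=
  GRing.isSubmodClosed.Build k 'M[k]_2 traceless traceless_submod_closed.

Record sl2 := Sl2 { sl2_mx : 'M[k]_2; _ : sl2_mx \in traceless }.

HB.instance Definition _ := [isSub for sl2_mx].
HB.instance Definition _ := [Choice of sl2 by <:].
HB.instance Definition _ := [SubChoice_isSubLmodule of sl2 by <:].

Lemma bracket_subproof (x y : sl2) :
  sl2_mx x *m sl2_mx y - sl2_mx y *m sl2_mx x \in traceless.
Proof. by rewrite /in_mem /= /traceless linearB /= mxtrace_mulC subrr. Qed.

Definition bracket (x y : sl2) : sl2 := Sl2 (bracket_subproof x y).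

Lemma sl2_e_subproof : delta_mx 0 1 \in traceless.
Proof.
by rewrite /in_mem /= /traceless /mxtrace !big_ord_recl big_ord0 !mxE /= !addr0.
Qed.

Lemma sl2_h_subproof : delta_mx 0 0 - delta_mx 1 1 \in traceless.
Proof.
rewrite /in_mem /= /traceless /mxtrace !big_ord_recl big_ord0 !mxE /=.
by rewrite subr0 sub0r addr0 subrr.
Qed.

Lemma sl2_f_subproof : delta_mx 1 0 \in traceless.
Proof.
by rewrite /in_mem /= /traceless /mxtrace !big_ord_recl big_ord0 !mxE /= !addr0.
Qed.

Definition sl2_e : sl2 := Sl2 sl2_e_subproof.
Definition sl2_h : sl2 := Sl2 sl2_h_subproof.
Definition sl2_f : sl2 := Sl2 sl2_f_subproof.

(* The symmetric algebra S of sl2 is {mpoly k[3]}, with 'X_0 = e, 'X_1 = h    *)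
(* and 'X_2 = f.                                                              *)
Definition Se : {mpoly k[3]} := 'X_0.
Definition Sh : {mpoly k[3]} := 'X_1.
Definition Sf : {mpoly k[3]} := 'X_2.

(* The matrix ((a, b), (c, -a)) is b e + a h + c f.                           *)
Definition sym_of_sl2 (x : sl2) : {mpoly k[3]} :=
  sl2_mx x 0 1 *: Se + sl2_mx x 0 0 *: Sh + sl2_mx x 1 0 *: Sf.

(* The derivation of S extending [x, -].                                      *)
Definition act (x : sl2) (s : {mpoly k[3]}) : {mpoly k[3]} :=
    sym_of_sl2 (bracket x sl2_e) * s^`M(0)
  + sym_of_sl2 (bracket x sl2_h) * s^`M(1)
  + sym_of_sl2 (bracket x sl2_f) * s^`M(2).

Lemma actM x s t : act x (s * t) = act x s * t + s * act x t.
Proof. by rewrite /act !mderivM; ring. Qed.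

Lemma actD x s t : act x (s + t) = act x s + act x t.
Proof. by rewrite /act !mderivD; ring. Qed.

Lemma actN x s : act x (- s) = - act x s.
Proof. by rewrite /act !mderivN; ring. Qed.

Lemma act0 x : act x 0 = 0.
Proof. by rewrite /act !mderiv0 !mulr0 !addr0. Qed.

Lemma actC x a : act x a%:MP = 0.
Proof. by rewrite /act !mderivC !mulr0 !addr0. Qed.

Lemma actX x s n : act x (s ^+ n.+1) = n.+1%:R * s ^+ n * act x s.
Proof.
elim: n => [|n IHn]; first by rewrite !expr1 expr0 !mul1r.
by rewrite exprS actM IHn (exprS s n) -(natr1 n.+1); ring.
Qed.

Definition casimir : {mpoly k[3]} := Sh ^+ 2 + 4 * Se * Sf.

Lemma sl2_mx11 (x : sl2) : sl2_mx x 1 1 = - sl2_mx x 0 0.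
Proof.
have /eqP := valP x; rewrite /mxtrace !big_ord_recl big_ord0 addr0 => /eqP.
by rewrite addrC addr_eq0 => /eqP <-; congr (sl2_mx x _ _); apply: val_inj.
Qed.

Lemma bracket_mxE (x y : sl2) i j :
  sl2_mx (bracket x y) i j =
    sl2_mx x i 0 * sl2_mx y 0 j + sl2_mx x i 1 * sl2_mx y 1 j
    - (sl2_mx y i 0 * sl2_mx x 0 j + sl2_mx y i 1 * sl2_mx x 1 j).
Proof.
rewrite /bracket /= !mxE !big_ord_recl !big_ord0 !addr0.
by rewrite (_ : lift ord0 ord0 = 1) //; apply: val_inj.
Qed.

Lemma actE x s :
  act x s = sl2_mx x 0 1 *: (Sh * s^`M(2) - 2 * Se * s^`M(1))
    + sl2_mx x 0 0 *: (2 * Se * s^`M(0) - 2 * Sf * s^`M(2))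
    + sl2_mx x 1 0 *: (2 * Sf * s^`M(1) - Sh * s^`M(0)).
Proof.
rewrite /act /sym_of_sl2 !bracket_mxE /= !mxE /= !sl2_mx11.
rewrite -!mul_mpolyC !(mpolyCD, mpolyCM, mpolyCB, mpolyCN, mpolyC0, mpolyC1).
ring.
Qed.

Lemma mderivU i j : ('X_i : {mpoly k[3]})^`M(j) = (i == j)%:R.
Proof.
rewrite mderivX mnm1E; case: eqVneq => [->|_]; last by rewrite scale0r.
rewrite scale1r -mpolyX0; congr 'X_[_].
by apply/mnmP=> l; rewrite mnmBE subnn mnm0E.
Qed.

Lemma act_Se x : act x Se = (2 * sl2_mx x 0 0) *: Se - sl2_mx x 1 0 *: Sh.
Proof.
rewrite actE /Se !mderivU /= -!mul_mpolyC mpolyCM mpolyC_nat; ring.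
Qed.

Lemma act_Sh x :
  act x Sh = (2 * sl2_mx x 1 0) *: Sf - (2 * sl2_mx x 0 1) *: Se.
Proof.
rewrite actE /Sh !mderivU /= -!mul_mpolyC !mpolyCM mpolyC_nat; ring.
Qed.

Lemma act_Sf x : act x Sf = sl2_mx x 0 1 *: Sh - (2 * sl2_mx x 0 0) *: Sf.
Proof.
rewrite actE /Sf !mderivU /= -!mul_mpolyC mpolyCM mpolyC_nat; ring.
Qed.

Lemma act_casimir x : act x casimir = 0.
Proof.
rewrite /casimir -[4](mpolyC_nat 3 k 4) actD expr2 !actM actC.
rewrite act_Se act_Sh act_Sf mpolyC_nat -!mul_mpolyC !mpolyCM mpolyC_nat; ring.
Qed.

Lemma act_natr x n : act x n%:R = 0.
Proof. by rewrite -mpolyC_nat actC. Qed.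

Lemma bracket_he : bracket sl2_h sl2_e = 2 *: sl2_e.
Proof.
apply/val_inj/matrixP=> i j; rewrite /= !mxE !big_ord_recl !big_ord0 !mxE.
by case: i j => [[|[]]] // ? [[|[]]] // ? /=; ring.
Qed.

Lemma bracket_hf : bracket sl2_h sl2_f = - 2 *: sl2_f.
Proof.
apply/val_inj/matrixP=> i j; rewrite /= !mxE !big_ord_recl !big_ord0 !mxE.
by case: i j => [[|[]]] // ? [[|[]]] // ? /=; ring.
Qed.

Lemma bracket_ef : bracket sl2_e sl2_f = sl2_h.
Proof.
apply/val_inj/matrixP=> i j; rewrite /= !mxE !big_ord_recl !big_ord0 !mxE.
by case: i j => [[|[]]] // ? [[|[]]] // ? /=; ring.
Qed.

Lemma actZ x a s : act x (a *: s) = a *: act x s.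
Proof. by rewrite -!mul_mpolyC actM actC mul0r add0r. Qed.

Lemma act_scale a x s : act (a *: x) s = a *: act x s.
Proof.
have E i j : sl2_mx (a *: x) i j = a * sl2_mx x i j by rewrite /= mxE.
by rewrite !actE !E -!mul_mpolyC !mpolyCM; ring.
Qed.

Lemma act_bracket x y s :
  act (bracket x y) s = act x (act y s) - act y (act x s).
Proof.
have E z t : act z t =
    (sl2_mx z 0 1)%:MP * (Sh * t^`M(2) - 2 * Se * t^`M(1))
    + (sl2_mx z 0 0)%:MP * (2 * Se * t^`M(0) - 2 * Sf * t^`M(2))
    + (sl2_mx z 1 0)%:MP * (2 * Sf * t^`M(1) - Sh * t^`M(0)).
  by rewrite actE !mul_mpolyC.
have Ee z : act z Se = 2 * (sl2_mx z 0 0)%:MP * Se - (sl2_mx z 1 0)%:MP * Sh.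
  by rewrite act_Se -!mul_mpolyC mpolyCM mpolyC_nat.
have Eh z : act z Sh =
    2 * (sl2_mx z 1 0)%:MP * Sf - 2 * (sl2_mx z 0 1)%:MP * Se.
  by rewrite act_Sh -!mul_mpolyC !mpolyCM mpolyC_nat.
have Ef z : act z Sf = (sl2_mx z 0 1)%:MP * Sh - 2 * (sl2_mx z 0 0)%:MP * Sf.
  by rewrite act_Sf -!mul_mpolyC mpolyCM mpolyC_nat.
rewrite ![act _ s]E !bracket_mxE !sl2_mx11.
rewrite !(mpolyCB, mpolyCD, mpolyCM, mpolyCN).
rewrite !(actD, actN, actM, actC, Ee, Eh, Ef, act_natr) !E.
rewrite (mderiv_comm 1 0) (mderiv_comm 2 0) (mderiv_comm 2 1).
move: (s^`M(0)) (s^`M(1)) (s^`M(2)) => s0 s1 s2.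
move: (s0^`M(0)) (s0^`M(1)) (s0^`M(2)) (s1^`M(1)) (s1^`M(2)) (s2^`M(2)).
move=> s00 s01 s02 s11 s12 s22.
move: (_%:MP) (_%:MP) (_%:MP) (_%:MP) (_%:MP) (_%:MP) => x0 x1 x2 x3 x4 x5.
move: Se Sh Sf => e h f.
ring.
Qed.

End Sl2.

Section Invariants.

Variables (k : fieldType) (p : nat).

(* Membership in the k-subalgebra Z of S generated by c, e^p, h^p, f^p.       *)
Inductive in_Z : {mpoly k[3]} -> Prop :=
| in_Z_const a : in_Z a%:MP
| in_Z_casimir : in_Z (casimir k)
| in_Z_ep : in_Z (Se k ^+ p)
| in_Z_hp : in_Z (Sh k ^+ p)
| in_Z_fp : in_Z (Sf k ^+ p)
| in_Z_add s t : in_Z s -> in_Z t -> in_Z (s + t)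
| in_Z_mul s t : in_Z s -> in_Z t -> in_Z (s * t).

Definition Zpred : {pred {mpoly k[3]}} := fun s => `[< in_Z s >].

Lemma ZpredP s : reflect (in_Z s) (s \in Zpred).
Proof. exact: asboolP. Qed.

Lemma Zpred_subring_closed : subring_closed Zpred.
Proof.
split=> [|s t /ZpredP sZ /ZpredP tZ|s t /ZpredP sZ /ZpredP tZ]; apply/ZpredP.
- by rewrite -mpolyC1; apply: in_Z_const.
- apply: in_Z_add => //; rewrite -mulN1r -mpolyC1 -mpolyCN.
  by apply: in_Z_mul => //; apply: in_Z_const.
- exact: in_Z_mul.
Qed.

HB.instance Definition _ :=
  GRing.isSubringClosed.Build {mpoly k[3]} Zpred Zpred_subring_closed.

Record Zalg := ZAlg { Zval : {mpoly k[3]}; _ : Zval \in Zpred }.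

HB.instance Definition _ := [isSub for Zval].
HB.instance Definition _ := [Choice of Zalg by <:].
HB.instance Definition _ := [SubChoice_isSubComNzRing of Zalg by <:].

Definition Zc : Zalg := ZAlg (introT (ZpredP _) in_Z_casimir).
Definition Zep : Zalg := ZAlg (introT (ZpredP _) in_Z_ep).
Definition Zhp : Zalg := ZAlg (introT (ZpredP _) in_Z_hp).
Definition Zfp : Zalg := ZAlg (introT (ZpredP _) in_Z_fp).

Lemma act_Z (charkp : p \in [pchar k]) x (z : Zalg) : act x (Zval z) = 0.
Proof.
have p_gt0 : (0 < p)%N by case/andP: charkp => /prime_gt0.
have actXp s : act x (s ^+ p) = 0.
  rewrite -(prednK p_gt0) actX prednK // -mpolyC_nat (pcharf0 charkp).
  by rewrite mpolyC0 !mul0r.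
case: z => s /= /ZpredP; elim=> {s} //; first exact: actC.
- exact: act_casimir.
- by move=> s t _ s0 _ t0; rewrite actD s0 t0 addr0.
- by move=> s t _ s0 _ t0; rewrite actM s0 t0 mul0r mulr0 addr0.
Qed.

End Invariants.

Section Cochains.

Variable k : fieldType.

(* A 2-cochain alpha : wedge^2 sl2 -> S is encoded as                         *)
(* (alpha (e /\ h), alpha (e /\ f), alpha (h /\ f)).                          *)
Local Notation cochain2 := ({mpoly k[3]} * {mpoly k[3]} * {mpoly k[3]})%type.

Definition cocycle_pred : {pred cochain2} := fun a =>
  act (sl2_e k) a.2 + act (sl2_f k) a.1.1 == act (sl2_h k) a.1.2.

Lemma cocycle_zmod_closed : zmod_closed cocycle_pred.
Proof.
split=> [|a b]; rewrite /in_mem /= /cocycle_pred /= ?act0 ?addr0 //.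
by move=> /eqP az /eqP bz; rewrite !actD !actN -az -bz; apply/eqP; ring.
Qed.

HB.instance Definition _ :=
  GRing.isZmodClosed.Build cochain2 cocycle_pred cocycle_zmod_closed.

Record cocycle2 := Cocycle2 { cocycle2_val : cochain2;
                              _ : cocycle2_val \in cocycle_pred }.

HB.instance Definition _ := [isSub for cocycle2_val].
HB.instance Definition _ := [Choice of cocycle2 by <:].
HB.instance Definition _ := [SubChoice_isSubZmodule of cocycle2 by <:].

Definition dcochain1 (b : {linear sl2 k -> {mpoly k[3]}}) (x y : sl2 k) :
    {mpoly k[3]} :=
  act x (b y) - act y (b x) - b (bracket x y).

Definition coboundary2 (b : {linear sl2 k -> {mpoly k[3]}}) : cochain2 :=
  (dcochain1 b (sl2_e k) (sl2_h k), dcochain1 b (sl2_e k) (sl2_f k),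
   dcochain1 b (sl2_h k) (sl2_f k)).

Lemma coboundary2_cocycle b : coboundary2 b \in cocycle_pred.
Proof.
rewrite /in_mem /= /cocycle_pred /= /dcochain1.
have -> : bracket (sl2_e k) (sl2_h k) = - 2 *: sl2_e k.
  rewrite scaleNr -bracket_he; apply/val_inj/matrixP=> i j.
  by rewrite /= !mxE; ring.
rewrite bracket_hf bracket_ef !linearZ /= !scaleNr !scalerN !opprK.
have actB x s t : act x (s - t) = act x s - act x t by rewrite actD actN.
rewrite 2!(actD _ (act _ _ - act _ _)) !actB !actZ; apply/eqP.
have := act_bracket (sl2_e k) (sl2_f k) (b (sl2_h k)).
have := act_bracket (sl2_h k) (sl2_f k) (b (sl2_e k)).
have := act_bracket (sl2_h k) (sl2_e k) (b (sl2_f k)).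
rewrite bracket_he bracket_hf bracket_ef !act_scale !scaleNr.
move: (act _ (b _)) (act _ (act _ _)) (act _ (b _)) => u v w.
move: (act _ w) (act _ u) (act _ (act _ _)) => w1 u1 u2.
move: (act _ (b _)) (act _ (act _ _)) (act _ (act _ _)) => t v1 v2.
by move=> /esym/(canRL (subrK _)) -> /esym/(canRL (subrK _)) -> ->; ring.
Qed.

Definition coboundary_pred : {pred cocycle2} := fun a =>
  `[< exists b : {linear sl2 k -> {mpoly k[3]}},
        cocycle2_val a = coboundary2 b >].

Lemma coboundary_zmod_closed : zmod_closed coboundary_pred.
Proof.
split=> [|a b]; rewrite /in_mem /= /coboundary_pred.
  apply/asboolP; exists \0; rewrite /coboundary2 /dcochain1 /=.
  by rewrite !act0 !subr0.
move=> /asboolP [u au] /asboolP [v bv]; apply/asboolP; exists (u \- v).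
rewrite [LHS](raddfB val) /= au bv /coboundary2 /dcochain1 /=.
by congr (_, _, _) => /=; rewrite !actD !actN; ring.
Qed.

HB.instance Definition _ :=
  GRing.isZmodClosed.Build cocycle2 coboundary_pred coboundary_zmod_closed.

Lemma cocycle_hpow n : (Se k * Sh k ^+ n, 0, Sf k * Sh k ^+ n) \in cocycle_pred.
Proof.
rewrite /in_mem /= /cocycle_pred /= act0 !actM act_Se act_Sf /=.
rewrite !mxE /= !mulr0 !scale0r !sub0r !subr0 !scale1r.
case: n => [|n]; first by rewrite expr0 -[1](mpolyC1 3 k) !actC;
  apply/eqP; ring.
rewrite !actX !act_Sh /= !mxE /= !mulr0 !scale0r !sub0r !subr0 !mulr1.
by rewrite -!mul_mpolyC mpolyC_nat; apply/eqP; ring.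
Qed.

Lemma cocycle_fpow n : (Sf k ^+ n, 0, 0) \in cocycle_pred.
Proof.
rewrite /in_mem /= /cocycle_pred /= !act0 add0r.
case: n => [|n]; first by rewrite expr0 -[1](mpolyC1 3 k) !actC.
by rewrite actX act_Sf /= !mxE /= !mulr0 !scale0r subrr mulr0.
Qed.

Lemma cocycle_epow n : (0, 0, Se k ^+ n) \in cocycle_pred.
Proof.
rewrite /in_mem /= /cocycle_pred /= !act0 addr0.
case: n => [|n]; first by rewrite expr0 -[1](mpolyC1 3 k) !actC.
by rewrite actX act_Se /= !mxE /= !mulr0 !scale0r subrr mulr0.
Qed.

Variable p : nat.

Definition cocycle_Re : cocycle2 := Cocycle2 (cocycle_fpow p.-1).
Definition cocycle_Rh : cocycle2 := Cocycle2 (cocycle_hpow p.-2).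
Definition cocycle_Rf : cocycle2 := Cocycle2 (cocycle_epow p.-1).
Definition cocycle_T : cocycle2 := Cocycle2 (cocycle_hpow p.-1).

(* The characteristic hypothesis is not needed to form this group, but its    *)
(* Z-module structure, defined below, depends on it.                          *)
Definition Ext2 (charkp : p \in [pchar k]) := Quotient.quot coboundary_pred.

End Cochains.

Section Ext2.

Variables (k : fieldType) (p : nat) (charkp : p \in [pchar k]).

Local Notation cochain2 := ({mpoly k[3]} * {mpoly k[3]} * {mpoly k[3]})%type.
Local Notation quotB := (Quotient.quot (@coboundary_pred k)).
Local Notation Ext2 := (Ext2 charkp).
Local Notation Z := (Zalg k p).

HB.instance Definition _ := GRing.Zmodule.on Ext2.

Definition Ext2_class (a : cocycle2 k) : Ext2 := \pi_quotB a.

Lemma Ext2_classD a b : Ext2_class (a + b) = Ext2_class a + Ext2_class b.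
Proof. exact: raddfD. Qed.

Lemma Ext2_class_eqP a b :
  Ext2_class a = Ext2_class b <-> coboundary_pred (a - b).
Proof.
rewrite /Ext2_class; split=> [/eqP|ab]; first by rewrite -Quotient.idealrBE.
by apply/eqP; rewrite -Quotient.idealrBE.
Qed.

Lemma Ext2_class_surj x : exists a, Ext2_class a = x.
Proof. by exists (repr (x : quotB)); apply: reprK. Qed.

Definition scale_cochain (z : {mpoly k[3]}) (a : cochain2) : cochain2 :=
  (z * a.1.1, z * a.1.2, z * a.2).

Lemma scale_cocycle_subproof (z : Z) (a : cocycle2 k) :
  scale_cochain (Zval z) (cocycle2_val a) \in @cocycle_pred k.
Proof.
case: a => a az; move: az; rewrite /in_mem /= /cocycle_pred /= => /eqP az.
by rewrite !actM !(act_Z charkp) !mul0r !add0r -mulrDr az.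
Qed.

Definition scale_cocycle (z : Z) (a : cocycle2 k) : cocycle2 k :=
  Cocycle2 (scale_cocycle_subproof z a).

Lemma scale_coboundary z a :
  coboundary_pred a -> coboundary_pred (scale_cocycle z a).
Proof.
move=> /asboolP [b ab]; apply/asboolP.
have zb_lin : linear (fun x => Zval z * b x).
  by move=> c x y; rewrite linearP mulrDr scalerAr.
pose zbL := GRing.isLinear.Build _ _ _ _ _ zb_lin.
pose zb : {linear sl2 k -> {mpoly k[3]}} := HB.pack (fun x => Zval z * b x) zbL.
exists zb; rewrite /= ab /coboundary2 /dcochain1 /=.
by congr (_, _, _) => /=; rewrite !actM !(act_Z charkp); ring.
Qed.

Definition Ext2_scale (z : Z) (x : Ext2) : Ext2 :=
  Ext2_class (scale_cocycle z (repr (x : quotB))).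

Lemma Ext2_scale_class z a :
  Ext2_scale z (Ext2_class a) = Ext2_class (scale_cocycle z a).
Proof.
apply/Ext2_class_eqP.
have -> (b c : cocycle2 k) :
    scale_cocycle z b - scale_cocycle z c = scale_cocycle z (b - c).
  by apply: val_inj; congr (_, _, _); rewrite /= mulrBr.
by apply: scale_coboundary; apply/Ext2_class_eqP; apply: reprK.
Qed.

Lemma Ext2_scaleA z t x : Ext2_scale z (Ext2_scale t x) = Ext2_scale (z * t) x.
Proof.
have [a <-] := Ext2_class_surj x; rewrite !Ext2_scale_class; congr Ext2_class.
by apply: val_inj; congr (_, _, _); rewrite /= mulrA.
Qed.

Lemma Ext2_scale1 : left_id 1 Ext2_scale.
Proof.
move=> x; have [a <-] := Ext2_class_surj x; rewrite Ext2_scale_class.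
by congr Ext2_class; apply: val_inj; case: a => -[[? ?] ?] ?; congr (_, _, _);
  rewrite /= mul1r.
Qed.

Lemma Ext2_scaleDr : right_distributive Ext2_scale +%R.
Proof.
move=> z x y; have [a <-] := Ext2_class_surj x.
have [b <-] := Ext2_class_surj y.
rewrite -Ext2_classD !Ext2_scale_class -Ext2_classD; congr Ext2_class.
by apply: val_inj; congr (_, _, _); rewrite /= mulrDr.
Qed.

Lemma Ext2_scaleDl x : {morph Ext2_scale^~ x : z t / z + t}.
Proof.
move=> z t; have [a <-] := Ext2_class_surj x.
rewrite !Ext2_scale_class -Ext2_classD; congr Ext2_class.
by apply: val_inj; congr (_, _, _); rewrite /= mulrDl.
Qed.

HB.instance Definition _ := GRing.Zmodule_isLmodule.Build Z Ext2
  Ext2_scaleA Ext2_scale1 Ext2_scaleDr Ext2_scaleDl.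

Lemma Ext2_classZ (z : Z) a :
  z *: Ext2_class a = Ext2_class (scale_cocycle z a).
Proof. exact: Ext2_scale_class. Qed.

End Ext2.

(* Main.v *)
Require Import Defs.
From HB Require Import structures.
From mathcomp Require Import all_boot all_order all_algebra mpoly.
From mathcomp Require Import boolp zify ring.

Set Implicit Arguments.
Unset Strict Implicit.
Unset Printing Implicit Defensive.

Import GRing.Theory.
Local Open Scope ring_scope.

(** Write De, Dh, Df for the actions of e, h, f on S. They are the Hamiltonian
derivations of the Poisson structure on S, and everything below reduces to
calculus in the one variable h over the ring Z of invariants.

Weights. Monomials are eigenvectors of Dh, so S splits into weight spaces, with
weights in the prime field. A cochain of nonzero weight that is a cocycle is a
coboundary (Cartan homotopy), so a class is represented by (A, C, B) with A of
weight 2, C of weight 0, B of weight -2, and subtracting the coboundary of the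
1-cochain supported on h makes C = 0. The cocycle condition becomes
De B + Df A = 0. A polynomial of weight 0 is a Z-linear combination of the
powers h^i with i < p, because ef = (c - h^2) / 4 (weight0_poly_h); among
these, only the elements of Z are killed by De (invariant_Z).

Generation. The condition De B + Df A = 0 says exactly that f A - e B is
invariant. An element of Z in the ideal (e, f) of S has the form
f^p a - e^p b with a, b in Z (Z_ideal_ef); subtracting a R_e + b R_f gives
f A = e B, hence A = e P and B = f P with P of weight 0, i.e. P is a
Z-combination of the h^i. The classes K_i of (e h^i, 0, f h^i) satisfy
(i + 2)(i + 1) K_i = i (i - 1) c K_(i-2) (radial_recurrence), so K_i = 0 for
i <= p - 3. What remains are K_(p-2) = R_h and K_(p-1) = T.

Relation. As (4ef)^(p-1) = (c - h^2)^(p-1) is the sum of the c^(p-1-i) h^(2i)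
over i < p in characteristic p (ef_expand), the combination
e^p R_e + f^p R_f - h^p R_h - c^((p-1)/2) T is the sum of the
c^(p-1-i) K_(2i) over i different from (p-1)/2 and p-1. Each of these K_(2i)
vanishes, because h^p is in Z and 2i is at most p - 3 up to a multiple of p.

No other relation. Let a R_e + b R_f + d R_h + t T be a coboundary (A, 0, B).
Then h A is in the image of De and h B in the image of Df, while
De^p = Df^p = 0. Applying De^(p-1) or Df^(p-1), which extracts the coefficient
of h^(p-1), gives a h^p + d e^p = 0 and b h^p + d f^p = 0; and weights force
De^(p-1) A = 0, which gives a c^((p-1)/2) + t e^p = 0. Since e and h are
coprime, e^p divides a, the quotient is again invariant, and (a, b, d, t) is a
multiple of the relation (coboundary_comb). *)

Section Sl2Cohomology.

Variable k : fieldType.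

Local Notation S := {mpoly k[3]}.
Local Notation e := (Se k).
Local Notation h := (Sh k).
Local Notation f := (Sf k).
Local Notation c := (casimir k).
Local Notation De := (act (sl2_e k)).
Local Notation Dh := (act (sl2_h k)).
Local Notation Df := (act (sl2_f k)).

(** * The action of e, h and f on S *)

Lemma DeE s : De s = h * s^`M(2) - 2 * e * s^`M(1).
Proof. by rewrite actE /= !mxE /= !scale0r !addr0 scale1r. Qed.

Lemma DhE s : Dh s = 2 * e * s^`M(0) - 2 * f * s^`M(2).
Proof. by rewrite actE /= !mxE /= !subr0 !scale0r add0r addr0 scale1r. Qed.

Lemma DfE s : Df s = 2 * f * s^`M(1) - h * s^`M(0).
Proof. by rewrite actE /= !mxE /= ?subrr !scale0r !add0r scale1r. Qed.

Lemma De_e : De e = 0. Proof. by rewrite DeE !mderivU /=; ring. Qed.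
Lemma De_h : De h = - 2 * e. Proof. by rewrite DeE !mderivU /=; ring. Qed.
Lemma De_f : De f = h. Proof. by rewrite DeE !mderivU /=; ring. Qed.
Lemma Dh_e : Dh e = 2 * e. Proof. by rewrite DhE !mderivU /=; ring. Qed.
Lemma Dh_h : Dh h = 0. Proof. by rewrite DhE !mderivU /=; ring. Qed.
Lemma Dh_f : Dh f = - 2 * f. Proof. by rewrite DhE !mderivU /=; ring. Qed.
Lemma Df_e : Df e = - h. Proof. by rewrite DfE !mderivU /=; ring. Qed.
Lemma Df_h : Df h = 2 * f. Proof. by rewrite DfE !mderivU /=; ring. Qed.
Lemma Df_f : Df f = 0. Proof. by rewrite DfE !mderivU /=; ring. Qed.

Definition actsE := (De_e, De_h, De_f, Dh_e, Dh_h, Dh_f, Df_e, Df_h, Df_f).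

Lemma actB x (s t : S) : act x (s - t) = act x s - act x t.
Proof. by rewrite actD actN. Qed.

Lemma act_sum x (I : Type) (r : seq I) (P : pred I) (F : I -> S) :
  act x (\sum_(i <- r | P i) F i) = \sum_(i <- r | P i) act x (F i).
Proof. exact: (big_morph _ (actD x) (act0 x)). Qed.

Lemma actMnat x n (s : S) : act x (n%:R * s) = n%:R * act x s.
Proof. by rewrite actM act_natr mul0r add0r. Qed.

Lemma act_exp x (s : S) n : act x (s ^+ n) = n%:R * s ^+ n.-1 * act x s.
Proof.
case: n => [|n]; last exact: actX.
by rewrite expr0 -[1]/(1%:R) act_natr !mul0r.
Qed.

(** The derivations are tangent to the level sets of c: the left-hand side is
the Poisson bracket of c with s, up to a scalar. *)
Lemma act_casimir_tangent s : 2 * e * Df s + 2 * f * De s + h * Dh s = 0.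
Proof. by rewrite DeE DhE DfE; ring. Qed.

Lemma De_f_comm s : De (Df s) = Df (De s) + Dh s.
Proof. by rewrite -{1}bracket_ef act_bracket addrC subrK. Qed.

Lemma Dh_e_comm s : Dh (De s) = De (Dh s) + 2 * De s.
Proof.
have := act_bracket (sl2_h k) (sl2_e k) s.
by rewrite bracket_he act_scale -mul_mpolyC mpolyC_nat => ->; rewrite addrC subrK.
Qed.

Lemma Dh_f_comm s : Dh (Df s) = Df (Dh s) - 2 * Df s.
Proof.
have := act_bracket (sl2_h k) (sl2_f k) s.
rewrite bracket_hf act_scale scaleNr -mul_mpolyC mpolyC_nat => ->.
by rewrite addrC subrK.
Qed.

(** * Weights *)

Definition weight (m : 'X_{1..3}) : k := 2 * ((m 0)%:R - (m 2)%:R).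

Lemma mpolyX3 (m : 'X_{1..3}) :
  'X_[m] = e ^+ m 0 * h ^+ m 1 * f ^+ m 2 :> S.
Proof.
rewrite mpolyXE_id !big_ord_recl big_ord0 mulr1 mulrA /Se /Sh /Sf.
congr (_ ^+ m _ * _ ^+ m _ * 'X_ _ ^+ m _); try exact: val_inj.
Qed.

Lemma Dh_mpolyX m : Dh 'X_[m] = weight m *: 'X_[m].
Proof.
rewrite mpolyX3 !actM !act_exp !actsE /weight -mul_mpolyC.
rewrite mpolyCM mpolyCB !mpolyC_nat.
by case: (m 0) (m 2) => [|a] [|b] /=; rewrite ?expr0 ?exprS; ring.
Qed.

Lemma Dh_coef s m : (Dh s)@_m = weight m * s@_m.
Proof.
rewrite [in LHS](mpolyE s) act_sum (raddf_sum (mcoeff m)) /=.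
under eq_bigr => i _ do rewrite actZ Dh_mpolyX scalerA mcoeffZ mcoeffX.
rewrite [in RHS](mpolyE s) (raddf_sum (mcoeff m)) mulr_sumr /=.
apply: eq_bigr => i _; rewrite mcoeffZ mcoeffX.
by case: eqVneq => [->|]; rewrite ?mulr1 ?mulr0 // mulrC.
Qed.

(** Each component of s of weight different from w lies in the image of
Dh - w, since Dh - w acts on it by a nonzero scalar; so s has weight w modulo
that image. *)
Lemma weight_split (w : k) s :
  exists x, Dh (s - (Dh x - w *: x)) = w *: (s - (Dh x - w *: x)).
Proof.
(* On monomials of weight w the quotient is 0 by convention, as wanted. *)
pose x : S := \sum_(m <- msupp s) (s@_m / (weight m - w)) *: 'X_[m].
have xE m : x@_m = s@_m / (weight m - w).
  have -> : s@_m = \sum_(i <- msupp s) s@_i * (i == m)%:R.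
    rewrite [in LHS](mpolyE s) (raddf_sum (mcoeff m)) /=.
    by apply: eq_bigr => i _; rewrite mcoeffZ mcoeffX.
  rewrite /x (raddf_sum (mcoeff m)) mulr_suml /=; apply: eq_bigr => i _.
  rewrite mcoeffZ mcoeffX.
  by case: eqVneq => [->|]; rewrite ?mulr1 ?mulr0 ?mul0r.
exists x; apply/mpolyP => m.
rewrite Dh_coef mcoeffZ !mcoeffB Dh_coef mcoeffZ xE.
have [->//|ne] := eqVneq (weight m) w.
have ne' : weight m - w != 0 by rewrite subr_eq0.
have -> : s@_m - (weight m * (s@_m / (weight m - w))
    - w * (s@_m / (weight m - w))) = 0.
  by field.
by rewrite !mulr0.
Qed.

Lemma Dh_semisimple s : Dh (Dh s) = 0 -> Dh s = 0.
Proof.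
move=> s0; apply/mpolyP => m; move/mpolyP/(_ m): s0.
rewrite !Dh_coef mcoeff0 mulrA -expr2 => /eqP.
by rewrite mulf_eq0 sqrf_eq0 => /orP[] /eqP ->; rewrite ?mulr0 ?mul0r.
Qed.

(** * Iterated derivations *)

Lemma iter_act0 x n : iter n (act x) 0 = 0 :> S.
Proof. by elim: n => //= n ->; rewrite act0. Qed.

Lemma iter_actD x n (s t : S) :
  iter n (act x) (s + t) = iter n (act x) s + iter n (act x) t.
Proof. by elim: n => //= n ->; rewrite actD. Qed.

Lemma iter_actN x n (s : S) : iter n (act x) (- s) = - iter n (act x) s.
Proof. by elim: n => //= n ->; rewrite actN. Qed.

Lemma iter_act_sum x n (I : Type) (r : seq I) (P : pred I) (F : I -> S) :
  iter n (act x) (\sum_(i <- r | P i) F i) =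
  \sum_(i <- r | P i) iter n (act x) (F i).
Proof. exact: (big_morph _ (iter_actD x n) (iter_act0 x n)). Qed.

Lemma iter_act_invl x n (z s : S) :
  act x z = 0 -> iter n (act x) (z * s) = z * iter n (act x) s.
Proof. by move=> z0; elim: n => //= n ->; rewrite actM z0 mul0r add0r. Qed.

Lemma iter_act_exp x (s t : S) n m : act x s = t -> act x t = 0 ->
  iter n (act x) (s ^+ m) = (m ^_ n)%:R * t ^+ n * s ^+ (m - n).
Proof.
move=> st t0; elim: n => [|n IHn].
  by rewrite ffactn0 mul1r expr0 mul1r subn0.
rewrite iterS IHn -mulrA actMnat actM act_exp t0 mulr0 mul0r add0r act_exp st.
by rewrite ffactnSr natrM subnS exprS; ring.
Qed.

Lemma iter_actM x n (s t : S) : iter n (act x) (s * t) =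
  \sum_(i < n.+1) 'C(n, i)%:R * (iter i (act x) s * iter (n - i) (act x) t).
Proof.
elim: n => [|n IHn]; first by rewrite big_ord1 /= bin0 mul1r.
rewrite iterS IHn act_sum.
under eq_bigr => i _.
  rewrite actMnat actM -!iterS -subSn ?(leq_ord i) // mulrDr.
  over.
rewrite big_split /= [RHS]big_ord_recl /= bin0 mul1r.
under [in RHS]eq_bigr => i _ do
  rewrite /bump /= add1n binS natrD mulrDl subSS addrC.
rewrite big_split /= addrCA; congr (_ + _).
rewrite big_ord_recl /= bin0 mul1r; congr (_ + _).
rewrite [RHS]big_ord_recr /= (bin_small (ltnSn n)) mul0r addr0.
by apply: eq_bigr => i _; rewrite /bump /= add1n subSS.
Qed.

Section Char.

Variables (p : nat) (charkp : p \in [pchar k]) (p_gt2 : (2 < p)%N).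

Local Notation Z := (Zalg k p).
Local Notation v := (@Zval k p).

Lemma pcharS : p \in [pchar S].
Proof. by rewrite (rmorph_pchar (@mpolyC 3 k)). Qed.

(** The p-th power of a derivation is a derivation: the intermediate binomial
coefficients of the Leibniz formula vanish in characteristic p. *)
Lemma iter_act_pcharM x (s t : S) :
  iter p (act x) (s * t) = iter p (act x) s * t + s * iter p (act x) t.
Proof.
have p_pr : prime p by case/andP: charkp.
rewrite iter_actM -(prednK (prime_gt0 p_pr)) big_ord_recl big_ord_recr /=.
rewrite ?subSS ?subn0 /bump /= !add1n !prednK ?prime_gt0 // bin0.
rewrite binn subnn !mul1r big1 => [|i _]; first by rewrite add0r addrC.
have /dvdnP [q ->] : (p %| 'C(p, 1 + i))%N.
  by apply: prime_dvd_bin => //; have := ltn_ord i; lia.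
by rewrite natrM (pcharf0 pcharS) mulr0 mul0r.
Qed.

(** A derivation that vanishes on the generators vanishes; here it is the p-th
power of [act x], and p is at least 3. *)
Lemma iter_act_nilpotent x (s : S) :
    iter 3 (act x) e = 0 -> iter 3 (act x) h = 0 -> iter 3 (act x) f = 0 ->
  iter p (act x) s = 0.
Proof.
move=> e0 h0 f0.
have P3 t : iter 3 (act x) t = 0 -> iter p (act x) t = 0.
  by move=> t0; rewrite -(subnK p_gt2) iterD t0 iter_act0.
have PX t n : iter p (act x) t = 0 -> iter p (act x) (t ^+ n) = 0.
  move=> t0; elim: n => [|n IHn].
    by rewrite expr0 -(mpolyC1 3 k); apply: P3; rewrite iterSr actC iter_act0.
  by rewrite exprS iter_act_pcharM t0 IHn mul0r mulr0 addr0.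
rewrite (mpolyE s) iter_act_sum big1 // => m _.
rewrite -mul_mpolyC iter_act_invl ?actC // mpolyX3.
by rewrite !iter_act_pcharM !PX ?P3 // !(mul0r, mulr0, addr0).
Qed.

Lemma iter_De_p (s : S) : iter p De s = 0.
Proof.
by apply: iter_act_nilpotent;
  rewrite //= !(actsE, mulNr, actN, actMnat, act0, mulr0, oppr0).
Qed.

Lemma iter_Df_p (s : S) : iter p Df s = 0.
Proof.
by apply: iter_act_nilpotent;
  rewrite //= !(actsE, mulNr, actN, actMnat, act0, mulr0, oppr0).
Qed.

(** * Divisibility by the variables *)

Definition kill (i : 'I_3) : S -> S :=
  comp_mpoly [tuple if j == i then 0 else 'X_j | j < 3].

HB.instance Definition _ i := GRing.RMorphism.on (kill i).

Lemma killX i j : kill i 'X_j = if j == i then 0 else 'X_j.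
Proof. by rewrite /kill comp_mpolyXU -tnth_nth tnth_mktuple. Qed.

Lemma kill_mod i s : exists q, s = 'X_i * q + kill i s.
Proof.
elim/mpolyind: s => [|a m s _ _ [q sq]]; first by exists 0; rewrite rmorph0; ring.
have [r mr] : exists r, 'X_[m] = 'X_i * r + kill i 'X_[m].
  have stab (s1 s2 : S) : (exists r, s1 = 'X_i * r + kill i s1) ->
      (exists r, s2 = 'X_i * r + kill i s2) ->
      exists r, s1 * s2 = 'X_i * r + kill i (s1 * s2).
    move=> [r1 e1] [r2 e2]; exists (r1 * s2 + kill i s1 * r2).
    rewrite rmorphM /=; move: (kill i s1) (kill i s2) e1 e2 => a1 a2 -> ->; ring.
  rewrite mpolyXE_id; elim/big_rec: _ => [|j t _ IHt].
    by exists 0; rewrite rmorph1; ring.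
  apply: (stab) => //; elim: (m j) => [|n IHn]; first by exists 0; rewrite rmorph1; ring.
  rewrite exprS; apply: (stab) => //; rewrite killX.
  by case: eqVneq => [->|_]; [exists 1 | exists 0]; ring.
exists (a%:MP * r + q); rewrite rmorphD -mul_mpolyC rmorphM /=.
have -> : kill i a%:MP = a%:MP by exact: comp_mpolyC.
by move: (kill i 'X_[m]) (kill i s) mr sq => ? ? -> ->; ring.
Qed.

Lemma mpolyXU_neq0 (i : 'I_3) : 'X_i != 0 :> S.
Proof.
by apply/eqP => /mpolyP/(_ U_(i)%MM)/eqP; rewrite mcoeffXU eqxx mcoeff0 oner_eq0.
Qed.

(** Gauss's lemma for two distinct variables. The factors are peeled off one at
a time: 'X_i divides t iff t vanishes after setting 'X_i to 0. *)
Lemma mpolyX_exp_gauss (i j : 'I_3) m n (s t : S) : i != j ->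
  'X_i ^+ n * s = 'X_j ^+ m * t -> exists r, t = 'X_i ^+ n * r.
Proof.
move=> ne_ij; elim: n t => [|n IHn] t E; first by exists t; rewrite mul1r.
have kt : kill i t = 0.
  have /eqP := congr1 (kill i) E.
  rewrite !rmorphM !rmorphXn /= !killX eqxx [j == i]eq_sym (negPf ne_ij).
  rewrite exprS !mul0r eq_sym mulf_eq0 expf_eq0 (negPf (mpolyXU_neq0 j)) andbF.
  by move/eqP.
have [t' tt'] := kill_mod i t; rewrite kt addr0 in tt'.
have [|r rE] := IHn t'; last by exists r; rewrite tt' rE exprS; ring.
by apply: (mulfI (mpolyXU_neq0 i)); rewrite mulrA -exprS E tt'; ring.
Qed.

(** * The ring of invariants and the weight-zero part of S *)

HB.instance Definition _ :=
  GRing.RMorphism.copy (@Zval k p) (val : Zalg k p -> S).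

Lemma odd_p : odd p.
Proof.
have p_pr : prime p by case/andP: charkp.
by have [|//] := even_prime p_pr => p2; move: p_gt2; rewrite p2.
Qed.

Lemma pchar_natr_neq0 (R : nzRingType) n : p \in [pchar R] ->
  (0 < n < p)%N -> n%:R != 0 :> R.
Proof.
move=> chR /andP[n0 np]; rewrite -(dvdn_pcharf chR).
by apply: contraL np => /(dvdn_leq n0); rewrite -leqNgt.
Qed.

Lemma natr_eq_mod a b : a%:R = b%:R :> k -> a = b %[mod p].
Proof.
wlog le_ab : a b / (a <= b)%N => [IH|] E.
  by case: (leqP a b) => [/IH/(_ E)//|/ltnW/IH/(_ (esym E))].
apply/eqP; rewrite eq_sym eqn_mod_dvd // (dvdn_pcharf charkp) natrB //.
by rewrite E subrr.
Qed.

Lemma fact_neq0 n : (n < p)%N -> n`!%:R != 0 :> S.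
Proof.
elim: n => [|n IHn] np; first exact: oner_neq0.
rewrite factS natrM mulf_neq0 ?IHn ?(ltnW np) //.
by rewrite (pchar_natr_neq0 pcharS).
Qed.

Lemma casimir_expp : c ^+ p = h ^+ p ^+ 2 + 4 * e ^+ p * f ^+ p.
Proof.
rewrite /casimir exprDn_pchar; last first.
  by rewrite pnatE ?pcharS //; case/andP: charkp.
have := pFrobenius_aut_nat pcharS 4; rewrite pFrobenius_autE => E.
by rewrite !exprMn E -expr2.
Qed.

(** The image of [poly_h] is the weight-zero part of S. *)
Definition poly_h (q : {poly Z}) : S := (map_poly v q).[h].

(** Division by X^p - h^p, which is monic with coefficients in Z. *)
Lemma poly_h_reduced q :
  exists z : nat -> Z, poly_h q = \sum_(i < p) v (z i) * h ^+ i.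
Proof.
pose d : {poly Z} := 'X^p - (Zhp k p)%:P.
have d_monic : d \is monic by apply: monicXnsubC; apply: ltn_trans p_gt2.
have d_size : size d = p.+1 by rewrite size_XnsubC //; apply: ltn_trans p_gt2.
pose r := Pdiv.Ring.rmodp q d.
have r_size : (size r <= p)%N.
  by rewrite -ltnS -d_size Pdiv.Ring.ltn_rmodp -size_poly_eq0 d_size.
exists (fun i => r`_i).
rewrite /poly_h (Pdiv.RingMonic.rdivp_eq d_monic q) -/r rmorphD rmorphM.
rewrite hornerD hornerM rmorphB /= map_polyXn map_polyC /= hornerD hornerN.
rewrite hornerXn hornerC /= subrr mulr0 add0r.
rewrite (@horner_coef_wide _ p) ?(leq_trans (size_poly _ _)) //.
by apply: eq_bigr => i _; rewrite coef_map.
Qed.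

(** A monomial e^i h^l f^j of weight 0 has i and j congruent modulo p, so it is
a product of powers of e^p, f^p, h and ef; and ef = (c - h^2) / 4. *)
Lemma weight0_poly_h s : Dh s = 0 ->
  exists z : nat -> Z, s = \sum_(i < p) v (z i) * h ^+ i.
Proof.
move=> s0; suff [q ->] : exists q, s = poly_h q by exact: poly_h_reduced.
have stD (s1 s2 : S) : (exists q, s1 = poly_h q) ->
    (exists q, s2 = poly_h q) -> exists q, s1 + s2 = poly_h q.
  by move=> [q1 ->] [q2 ->]; exists (q1 + q2); rewrite /poly_h rmorphD hornerD.
have stM (s1 s2 : S) : (exists q, s1 = poly_h q) ->
    (exists q, s2 = poly_h q) -> exists q, s1 * s2 = poly_h q.
  by move=> [q1 ->] [q2 ->]; exists (q1 * q2); rewrite /poly_h rmorphM hornerM.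
have stZ (z : Z) : exists q, v z = poly_h q.
  by exists z%:P; rewrite /poly_h map_polyC hornerC.
have st1 : exists q, 1 = poly_h q.
  by exists 1; rewrite /poly_h rmorph1 hornerC.
have stX (s1 : S) n : (exists q, s1 = poly_h q) ->
    exists q, s1 ^+ n = poly_h q.
  by move=> s1q; elim: n => [|n IHn]; rewrite ?expr0 // exprS; apply: (stM).
have sth : exists q, h = poly_h q.
  by exists 'X; rewrite /poly_h map_polyX hornerX.
have stef : exists q, e * f = poly_h q.
  have n4 : 4 != 0 :> k.
    by rewrite (natrM k 2 2) mulf_neq0 // pchar_natr_neq0.
  have -> : e * f = (4^-1)%:MP * (c - h ^+ 2).
    have : (4^-1)%:MP * 4 = 1 :> S.
      by rewrite -(mpolyC_nat 3 k 4) -mpolyCM mulVf // mpolyC1.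
    move: (_%:MP) => x E.
    by transitivity (x * 4 * (e * f)); [rewrite E mul1r | rewrite /casimir; ring].
  apply: (stM); first exact: (stZ (ZAlg (introT (ZpredP p _) (in_Z_const p _)))).
  apply: (stD); first exact: (stZ (Zc k p)).
  rewrite -mulN1r; apply: (stM); last exact: (stX).
  exact: (stZ (-1)).
rewrite (mpolyE s) big_seq; elim/big_rec: _ => [|m t ms].
  exact: (stZ 0).
apply: (stD); rewrite -mul_mpolyC; apply: (stM).
  exact: (stZ (ZAlg (introT (ZpredP p _) (in_Z_const p _)))).
have ms0 : s@_m != 0 by rewrite -mcoeff_msupp.
have wm : m 0 = m 2 %[mod p].
  move/mpolyP/(_ m): s0; rewrite Dh_coef mcoeff0 => /eqP.
  rewrite mulf_eq0 (negPf ms0) orbF /weight mulf_eq0.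
  rewrite (negPf (pchar_natr_neq0 charkp _)) ?p_gt2 //= subr_eq0 => /eqP.
  exact: natr_eq_mod.
rewrite mpolyX3 (divn_eq (m 0) p) (divn_eq (m 2) p) wm.
move: (_ %/ _)%N (_ %/ _)%N (_ %% _)%N => b a r.
have -> : e ^+ (a * p + r) * h ^+ m 1 * f ^+ (b * p + r) =
    (e ^+ p) ^+ a * (f ^+ p) ^+ b * (e * f) ^+ r * h ^+ m 1.
  by rewrite !exprD exprMn ![(_ * p)%N]mulnC !exprM; ring.
apply: (stM); last exact: stX.
apply: (stM); last exact: stX.
by apply: (stM); apply: (stX); [exact: (stZ (Zep k p)) | exact: (stZ (Zfp k p))].
Qed.

(** On polynomials in h over Z, De is -2 e d/dh. Its n-th iterate isolates
n! times the leading coefficient, which is therefore 0 when n > 0. *)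
Lemma invariant_poly_h n (z : nat -> Z) : (n <= p)%N ->
  De (\sum_(i < n) v (z i) * h ^+ i) = 0 ->
  exists t : Z, \sum_(i < n) v (z i) * h ^+ i = v t.
Proof.
elim: n => [|[|n] IHn] np; first by exists 0; rewrite big_ord0 rmorph0.
  by exists (z 0%N); rewrite big_ord1 mulr1.
move=> s0; have zn0 : v (z n.+1) = 0.
  have := congr1 (iter n De) s0; rewrite -iterSr iter_act0 iter_act_sum.
  rewrite big_ord_recr big1 /= => [|i _]; last first.
    rewrite -iterS iter_act_invl ?(act_Z charkp) // (iter_act_exp _ _ De_h).
      by rewrite ffact_small ?ltn_ord // !mul0r mulr0.
    by rewrite mulNr actN actMnat actsE mulr0 oppr0.
  rewrite add0r -iterS iter_act_invl ?(act_Z charkp) // (iter_act_exp _ _ De_h).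
    rewrite ffactnn subnn mulr1 => /eqP; rewrite mulf_eq0 => /orP[/eqP //|].
    rewrite mulf_eq0 (negPf (fact_neq0 _)) // expf_eq0 /= mulf_eq0 oppr_eq0.
    rewrite (negPf (pchar_natr_neq0 pcharS _)) ?p_gt2 //.
    by rewrite (negPf (mpolyXU_neq0 _)).
  by rewrite mulNr actN actMnat actsE mulr0 oppr0.
move: s0; rewrite big_ord_recr /= zn0 mul0r addr0 => s0.
exact: IHn (ltnW np) s0.
Qed.

Lemma invariant_Z s : De s = 0 -> Dh s = 0 -> exists z : Z, s = v z.
Proof.
move=> se /weight0_poly_h [z sz]; move: se; rewrite sz => se.
by have [t ->] := invariant_poly_h (leqnn p) se; exists t.
Qed.

(** * Invariants in the ideal (e, f) *)

Lemma casimir_poly_Z (P : {poly k}) : exists z : Z, horner_alg c P = v z.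
Proof.
elim/poly_ind: P => [|P a [z zP]]; first by exists 0; rewrite !rmorph0.
exists (z * Zc k p + ZAlg (introT (ZpredP p _) (in_Z_const p a))).
rewrite !(rmorphD, rmorphM) /= horner_algX horner_algC zP.
by rewrite -mul_mpolyC mulr1.
Qed.

(** The relation c^p = h^(2p) + 4 e^p f^p reduces the degree in h^p below 2
modulo the ideal (e^p, f^p) of Z. *)
Lemma Z_mod_ef s : in_Z p s -> exists (P Q : {poly k}) (a b : Z),
  s = horner_alg c P + h ^+ p * horner_alg c Q + f ^+ p * v a + e ^+ p * v b.
Proof.
elim=> {s} [a|||||s t _ [P1 [Q1 [a1 [b1 ->]]]] _ [P2 [Q2 [a2 [b2 ->]]]]
            |s t sZ [P1 [Q1 [a1 [b1 E1]]]] tZ [P2 [Q2 [a2 [b2 E2]]]]].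
- exists a%:P, 0, 0, 0; rewrite !rmorph0 horner_algC -mul_mpolyC; ring.
- exists 'X, 0, 0, 0; rewrite !rmorph0 horner_algX; ring.
- exists 0, 0, 0, 1; rewrite !rmorph0 rmorph1; ring.
- exists 0, 1, 0, 0; rewrite !rmorph0 rmorph1; ring.
- exists 0, 0, 1, 0; rewrite !rmorph0 rmorph1; ring.
- by exists (P1 + P2), (Q1 + Q2), (a1 + a2), (b1 + b2); rewrite !rmorphD; ring.
have [x1 X1] := casimir_poly_Z P1; have [y1 Y1] := casimir_poly_Z Q1.
have [x2 X2] := casimir_poly_Z P2; have [y2 Y2] := casimir_poly_Z Q2.
pose tz : Z := ZAlg (introT (ZpredP p _) tZ).
pose s0 : Z := x1 + Zhp k p * y1.
exists (P1 * P2 + 'X ^+ p * (Q1 * Q2)), (P1 * Q2 + Q1 * P2).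
exists (a1 * tz + s0 * a2), (b1 * tz + s0 * b2 - 4 * Zfp k p * (y1 * y2)).
rewrite !(rmorphD, rmorphM, rmorphN, rmorphXn, rmorph_nat) /=.
rewrite horner_algX casimir_expp X1 X2 Y1 Y2.
move: E1 E2; rewrite X1 Y1 X2 Y2 => -> ->; ring.
Qed.

Definition cartan_restr : S -> {poly k} :=
  mmap polyC (fun i : 'I_3 => if i == 1 then 'X else 0).

HB.instance Definition _ := GRing.RMorphism.on cartan_restr.

Lemma cartan_restrU i : cartan_restr 'X_i = if i == 1 then 'X else 0.
Proof. by rewrite /cartan_restr mmapX mmap1U. Qed.

Lemma cartan_restr_casimir (P : {poly k}) :
  cartan_restr (horner_alg c P) = P \Po 'X^2.
Proof.
elim/poly_ind: P => [|P a IHP]; first by rewrite !rmorph0.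
rewrite !(rmorphD, rmorphM) /= IHP horner_algX horner_algC.
rewrite comp_polyX comp_polyC -mul_mpolyC mulr1 /casimir.
rewrite !(rmorphD, rmorphM, rmorphXn) /= !cartan_restrU /=.
by rewrite !mulr0 addr0 /cartan_restr mmapC.
Qed.

(** Restricted to the line e = f = 0, the normal form of Z_mod_ef reads
P(h^2) + h^p Q(h^2). As p is odd, the two summands have opposite parities, so
P = Q = 0 as soon as the restriction vanishes. *)
Lemma Z_ideal_ef (z : Z) A B : v z = f * A - e * B ->
  exists a b : Z, v z = f ^+ p * v a - e ^+ p * v b.
Proof.
move=> zAB; have zZ : in_Z p (v z) by case: z {zAB} => s /= /ZpredP.
have p_gt0 : (0 < p)%N by apply: ltn_trans p_gt2.
have [P [Q [a [b E]]]] := Z_mod_ef zZ.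
have /polyP E0 : P \Po 'X^2 + 'X^p * (Q \Po 'X^2) = 0.
  have := congr1 cartan_restr E; rewrite {1}zAB.
  rewrite !(rmorphD, rmorphM, rmorphN, rmorphXn) /= !cartan_restrU /=.
  rewrite !cartan_restr_casimir expr0n gtn_eqF // !mul0r !addr0 oppr0.
  by rewrite add0r => <-.
have p_odd := odd_p.
have P0 : P = 0.
  apply/polyP => i; have := E0 (i * 2)%N.
  rewrite coefD coefXnM !coef_comp_poly_Xn // dvdn_mull // mulnK // !coef0.
  case: ltnP => [_|le_pi]; rewrite ?addr0 //.
  by rewrite dvdn2 oddB // p_odd muln2 odd_double addr0.
have Q0 : Q = 0.
  apply/polyP => i; have := E0 (p + i * 2)%N.
  rewrite P0 comp_poly0 add0r coefXnM ltnNge leq_addr /= addKn.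
  by rewrite coef_comp_poly_Xn // dvdn_mull // mulnK // !coef0.
exists a, (- b); rewrite E P0 Q0 !rmorph0 rmorphN; ring.
Qed.

(** * Coboundaries *)

Lemma bracket_eh : bracket (sl2_e k) (sl2_h k) = - 2 *: sl2_e k.
Proof.
rewrite scaleNr -bracket_he; apply/val_inj/matrixP=> i j.
by rewrite /= !mxE; ring.
Qed.

(** The witnesses are the values on e, h, f of a 1-cochain; the triple follows
the encoding of 2-cochains, (e /\ h, e /\ f, h /\ f). *)
Definition is_coboundary (A C B : S) := exists be bh bf : S,
  [/\ A = De bh - Dh be + 2 * be, C = De bf - Df be - bh
    & B = Dh bf - Df bh + 2 * bf].

Lemma is_coboundaryP A C B :
  is_coboundary A C B <-> exists b, (A, C, B) = coboundary2 b :> S * S * S.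
Proof.
have two n (s : S) : n%:R *: s = n%:R * s by rewrite -mul_mpolyC mpolyC_nat.
split=> [[be [bh [bf [-> -> ->]]]]|[b [-> -> ->]]]; last first.
  exists (b (sl2_e k)), (b (sl2_h k)), (b (sl2_f k)); rewrite /dcochain1.
  rewrite bracket_eh bracket_ef bracket_hf !linearZ /=.
  by rewrite !scaleNr !two !mulrN !opprK.
have b_lin : linear (fun x : sl2 k =>
    sl2_mx x 0 1 *: be + sl2_mx x 0 0 *: bh + sl2_mx x 1 0 *: bf).
  move=> a x y /=; rewrite !mxE -!mul_mpolyC !mpolyCD !mpolyCM; ring.
pose bL := GRing.isLinear.Build _ _ _ _ _ b_lin.
pose b : {linear sl2 k -> S} := HB.pack (fun x : sl2 k =>
  sl2_mx x 0 1 *: be + sl2_mx x 0 0 *: bh + sl2_mx x 1 0 *: bf) bL.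
have bE : b (sl2_e k) = be.
  by rewrite /= !mxE /= !scale0r !addr0 scale1r.
have bH : b (sl2_h k) = bh.
  by rewrite /= !mxE /= !subr0 !scale0r addr0 add0r scale1r.
have bF : b (sl2_f k) = bf.
  by rewrite /= !mxE /= ?subrr !scale0r !add0r scale1r.
clearbody b.
exists b; rewrite /coboundary2 /dcochain1 bracket_eh bracket_ef bracket_hf.
by rewrite !linearZ /= bE bH bF !scaleNr !two !mulrN !opprK.
Qed.

Lemma is_coboundaryD A C B A' C' B' : is_coboundary A C B ->
  is_coboundary A' C' B' -> is_coboundary (A + A') (C + C') (B + B').
Proof.
move=> [be [bh [bf [-> -> ->]]]] [be' [bh' [bf' [-> -> ->]]]].
by exists (be + be'), (bh + bh'), (bf + bf'); split; rewrite !actD; ring.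
Qed.

Lemma is_coboundaryM z A C B :
    De z = 0 -> Dh z = 0 -> Df z = 0 ->
  is_coboundary A C B -> is_coboundary (z * A) (z * C) (z * B).
Proof.
move=> ze zh zf [be [bh [bf [-> -> ->]]]].
by exists (z * be), (z * bh), (z * bf); split; rewrite !actM ?ze ?zh ?zf; ring.
Qed.

(** For P of weight 0, (e P, 0, f P) is a cocycle; R_h and T are the cases
P = h^(p-2) and P = h^(p-1). *)
Definition radial_trivial P := is_coboundary (e * P) 0 (f * P).

Lemma radial_trivialD P Q :
  radial_trivial P -> radial_trivial Q -> radial_trivial (P + Q).
Proof.
by move=> P0 Q0; have := is_coboundaryD P0 Q0; rewrite -!mulrDr addr0.
Qed.

Lemma radial_trivialM z P : De z = 0 -> Dh z = 0 -> Df z = 0 ->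
  radial_trivial P -> radial_trivial (z * P).
Proof.
move=> ze zh zf P0; rewrite /radial_trivial !(mulrCA _ z) -(mulr0 z).
exact: is_coboundaryM.
Qed.

Lemma radial_trivial0 : radial_trivial 0.
Proof. by exists 0, 0, 0; split; rewrite !act0; ring. Qed.

Lemma radial_trivial_sum (I : Type) (r : seq I) (Q : pred I) (F : I -> S) :
  (forall i, Q i -> radial_trivial (F i)) ->
  radial_trivial (\sum_(i <- r | Q i) F i).
Proof.
move=> F0; elim/big_rec: _ => [|i s Qi]; first exact: radial_trivial0.
by move=> s0; apply: radial_trivialD => //; apply: F0.
Qed.

(** The coboundary of a 1-cochain that vanishes on e has zero e /\ f component
as soon as its value on h is De of its value on f, here -2 f h^j. *)
Lemma radial_recurrence j : radial_trivial
  ((2 * j.+2 * j.+1)%:R * h ^+ j - (2 * j * j.-1)%:R * (c * h ^+ j.-2)).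
Proof.
exists 0, (j%:R * c * h ^+ j.-1 - j.+2%:R * h ^+ j.+1), (- (2 * f * h ^+ j)).
rewrite !(actB, actN, actM, act_natr, act_exp, actsE, act_casimir, act0) /casimir.
by case: j => [|[|j]]; split; rewrite /= ?expr0 ?exprS; ring.
Qed.

Lemma radial_trivialZ (z : Z) P : radial_trivial P -> radial_trivial (v z * P).
Proof. by apply: radial_trivialM; apply: act_Z. Qed.

(** The coefficient (j + 2)(j + 1) of the recurrence is invertible for
j < p - 2, and its other coefficient vanishes for j = 0 and j = 1; powers of
h^p are scalars from Z. *)
Lemma radial_low j : (j %% p < p.-2)%N -> radial_trivial (h ^+ j).
Proof.
move=> jp; rewrite (divn_eq j p) exprD mulnC exprM.
have -> : (h ^+ p) ^+ (j %/ p) = v (Zhp k p ^+ (j %/ p)) by rewrite rmorphXn.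
apply: radial_trivialZ; elim/ltn_ind: (j %% p)%N jp => {}j IHj jp.
have lt0 (n : nat) : (0 < n < p)%N -> n%:R != 0 :> k by exact: pchar_natr_neq0.
have n0 : (2 * j.+2 * j.+1)%:R != 0 :> k.
  by rewrite !natrM !mulf_neq0 // lt0 //; lia.
have -> : h ^+ j = (((2 * j.+2 * j.+1)%:R^-1)%:MP : S) *
  (((2 * j.+2 * j.+1)%:R * h ^+ j - (2 * j * j.-1)%:R * (c * h ^+ j.-2))
   + (2 * j * j.-1)%:R * (c * h ^+ j.-2)).
  by rewrite subrK mulrA -mpolyC_nat -mpolyCM mulVf // mpolyC1 mul1r.
apply: radial_trivialM; rewrite ?actC //.
apply: radial_trivialD; first exact: radial_recurrence.
case: j IHj {n0} jp => [|[|j]] IHj jp.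
- by rewrite !mul0r; apply: radial_trivial0.
- by rewrite muln0 !mul0r; apply: radial_trivial0.
apply: radial_trivialM; rewrite ?act_natr //.
by apply: (radial_trivialZ (Zc k p)); apply: IHj => //=; lia.
Qed.

(** * The four cocycles generate *)

Lemma natr_pred_p : p.-1%:R = -1 :> S.
Proof.
apply/eqP; rewrite -addr_eq0 natr1 prednK; last by lia.
by rewrite -(dvdn_pcharf pcharS).
Qed.

Lemma expr_pred (s : S) : s ^+ p.-1 = s ^+ p.-2 * s.
Proof. by move: p_gt2; case: p => [|[|n]] // _; rewrite -exprSr. Qed.

Lemma big_ord_last2 (F : nat -> S) :
  \sum_(i < p) F i = \sum_(i < p.-2) F i + F p.-2 + F p.-1.
Proof.
suff sum2 n : (1 < n)%N ->
    \sum_(i < n) F i = \sum_(i < n.-2) F i + F n.-2 + F n.-1.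
  exact: sum2 (ltnW p_gt2).
by case: n => [|[|n]] // _; rewrite !big_ord_recr.
Qed.

Lemma ord_pred2_mod (i : 'I_p.-2) : (i %% p < p.-2)%N.
Proof. by rewrite modn_small //; have := ltn_ord i; lia. Qed.

(** The generation argument: move to weights (2, 0, -2), kill the middle
component, correct by R_e and R_f until f A = e B, and discard the terms of
P = A / e in degrees below p - 2. *)
Lemma cocycle_generated A C B : De B + Df A = Dh C ->
  exists r1 r2 r3 r4 : Z, is_coboundary
    (A - (v r1 * f ^+ p.-1 + v r3 * (e * h ^+ p.-2) + v r4 * (e * h ^+ p.-1))) C
    (B - (v r2 * e ^+ p.-1 + v r3 * (f * h ^+ p.-2) + v r4 * (f * h ^+ p.-1))).
Proof.
have p_gt0 : (0 < p)%N by lia.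
move=> cocyc.
(* The coboundary of the cochain (-x, 0, y) corrects the weights of A and B. *)
have [x] := weight_split 2 A; set A0 := A - _ => A0w.
have [y] := weight_split (- 2) B; set B0 := B - _ => B0w.
rewrite -mul_mpolyC mpolyC_nat in A0w.
rewrite -mul_mpolyC mpolyCN mpolyC_nat in B0w.
pose C0 := C - De y - Df x.
have AE : A = A0 + (Dh x - 2 * x).
  by rewrite /A0 -mul_mpolyC mpolyC_nat subrK.
have BE : B = B0 + (Dh y + 2 * y).
  by rewrite /B0 -mul_mpolyC mpolyCN mpolyC_nat mulNr opprK subrK.
clearbody A0 B0.
have E0 : De B0 + Df A0 = Dh C0.
  rewrite /C0 (actB _ _ (Df x)) (actB _ C) Dh_e_comm Dh_f_comm -cocyc AE BE.
  rewrite (actD _ A0) (actD _ B0) (actB _ (Dh x)) (actD _ (Dh y)) !actMnat.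
  by ring.
have C0w : Dh C0 = 0.
  apply: Dh_semisimple; rewrite -E0 (actD _ (De B0)) Dh_e_comm Dh_f_comm A0w B0w.
  by rewrite mulNr actN !actMnat; ring.
(* The coboundary of (0, -C0, 0) removes the middle component. *)
pose A1 := A0 + De C0; pose B1 := B0 - Df C0.
have A1w : Dh A1 = 2 * A1.
  by rewrite /A1 (actD _ A0) A0w Dh_e_comm C0w act0; ring.
have B1w : Dh B1 = - 2 * B1.
  by rewrite /B1 (actB _ B0) B0w Dh_f_comm C0w act0; ring.
have E1 : De B1 + Df A1 = 0.
  rewrite /A1 /B1 (actD _ A0) (actB _ B0) De_f_comm C0w.
  move: E0; rewrite C0w => E0.
  by rewrite -[RHS]E0; ring.
have A1E : A = A1 - De C0 + (Dh x - 2 * x) by rewrite AE /A1; ring.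
have B1E : B = B1 + Df C0 + (Dh y + 2 * y) by rewrite BE /B1; ring.
clearbody A1 B1.
have [z zE] : exists z : Z, f * A1 - e * B1 = v z.
  apply: invariant_Z.
    (* Tangency to c at f A1, which has weight 0, divided by 2 f. *)
    have fA1 : De (f * A1) = - (e * Df A1).
      have n2 : 2 * f != 0 :> S.
        by rewrite mulf_neq0 ?mpolyXU_neq0 // (pchar_natr_neq0 pcharS).
      apply: (mulfI n2); apply/eqP.
      rewrite -subr_eq0 -(act_casimir_tangent (f * A1)).
      by rewrite !actM !actsE A1w; apply/eqP; ring.
    rewrite actB fA1 actM actsE.
    by transitivity (- (e * (De B1 + Df A1))); [ring | rewrite E1 mulr0 oppr0].
  by rewrite actB !actM !actsE A1w B1w; ring.
have [a [b zab]] := Z_ideal_ef (esym zE).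
have zE' : f * (A1 - v a * f ^+ p.-1) = e * (B1 - v b * e ^+ p.-1).
  have Ep (s : S) : s ^+ p = s * s ^+ p.-1 by rewrite -exprS prednK.
  apply/eqP; rewrite -subr_eq0; apply/eqP.
  transitivity (f * A1 - e * B1 - (f ^+ p * v a - e ^+ p * v b)).
    by rewrite !Ep; ring.
  by rewrite zE zab subrr.
have [P fP] : exists P, A1 - v a * f ^+ p.-1 = e * P.
  apply: (@mpolyX_exp_gauss 0 2 1 1 (B1 - v b * e ^+ p.-1)); first by [].
  exact: esym zE'.
have eQ : B1 - v b * e ^+ p.-1 = f * P.
  apply: (mulfI (mpolyXU_neq0 0)); rewrite -/(Se k).
  by rewrite -zE' fP; ring.
have {}A1w : Dh P = 0.
  apply: (mulfI (mpolyXU_neq0 0)); rewrite -/(Se k) mulr0.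
  have := congr1 Dh fP.
  rewrite actB !actM act_exp !actsE A1w (act_Z charkp) natr_pred_p => E.
  transitivity (2 * e * P + e * Dh P - 2 * (e * P)); first by ring.
  by rewrite -E -fP expr_pred; ring.
have [z' PE] := weight0_poly_h A1w.
rewrite (big_ord_last2 (fun i => v (z' i) * h ^+ i)) in PE.
have : radial_trivial (\sum_(i < p.-2) v (z' i) * h ^+ i).
  apply: radial_trivial_sum => i _; apply: radial_trivialZ; apply: radial_low.
  exact: ord_pred2_mod.
move: PE; set P' := \sum_(i < _) _ => PE P'0.
exists a, b, (z' p.-2), (z' p.-1).
have cx : is_coboundary (Dh x - 2 * x) (De y + Df x) (Dh y + 2 * y).
  by exists (- x), 0, y; split; rewrite ?actN ?act0; ring.
have cC : is_coboundary (- De C0) C0 (Df C0).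
  by exists 0, (- C0), 0; split; rewrite ?actN ?act0; ring.
have := is_coboundaryD (is_coboundaryD cx cC) P'0.
congr is_coboundary.
- rewrite A1E -[A1](subrK (v a * f ^+ p.-1)) fP PE; ring.
- by rewrite /C0; ring.
- rewrite B1E -[B1](subrK (v b * e ^+ p.-1)) eQ PE; ring.
Qed.

(** * The relation *)

(** Both sides agree after multiplication by 4ef = c - h^2: the right-hand side
becomes c^p - h^(2p), which is 4 e^p f^p. *)
Lemma ef_expand :
  (e * f) ^+ p.-1 = \sum_(i < p) c ^+ (p.-1 - i) * h ^+ (i * 2).
Proof.
have p_gt0 : (0 < p)%N by lia.
have n0 : 4 * (e * f) != 0 :> S.
  rewrite !mulf_neq0 ?mpolyXU_neq0 // (natrM S 2 2).
  by rewrite mulf_neq0 // (pchar_natr_neq0 pcharS).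
apply: (mulfI n0); transitivity (c ^+ p - (h ^+ 2) ^+ p).
  rewrite casimir_expp -!exprM (mulnC p) -mulrA -exprMn -{3}(prednK p_gt0).
  by rewrite exprS; ring.
rewrite subrXX; congr (_ * _); first by rewrite /casimir; ring.
apply: eq_bigr => i _; rewrite -exprM mulnC; congr (c ^+ _ * _).
Qed.

(** By ef_expand, the left-hand sides are e P and f P, where P is the sum of the
c^(p-1-i) h^(2i) without the terms i = p-1 and i = (p-1)/2: these two are
h^p h^(p-2) and c^((p-1)/2) h^(p-1). The remaining exponents 2i are congruent
modulo p to integers below p - 2. *)
Lemma relation_coboundary : is_coboundary
  (e ^+ p * f ^+ p.-1 - h ^+ p * (e * h ^+ p.-2)
     - c ^+ p.-1./2 * (e * h ^+ p.-1)) 0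
  (f ^+ p * e ^+ p.-1 - h ^+ p * (f * h ^+ p.-2)
     - c ^+ p.-1./2 * (f * h ^+ p.-1)).
Proof.
have p_odd := odd_p.
have p_gt0 : (0 < p)%N by lia.
have m2 : (p.-1./2 * 2 = p.-1)%N by lia.
have top_lt : (p.-1 < p)%N by lia.
have mid_lt : (p.-1./2 < p)%N by lia.
pose top := Ordinal top_lt; pose mid := Ordinal mid_lt.
have mid_top : mid != top by rewrite -val_eqE /=; apply/eqP; lia.
have : radial_trivial (\sum_(i < p | (i != top) && (i != mid))
    c ^+ (p.-1 - i) * h ^+ (i * 2)).
  apply: radial_trivial_sum => i /andP[it im].
  have -> : c ^+ (p.-1 - i) = v (Zc k p ^+ (p.-1 - i)) by rewrite rmorphXn.
  apply: radial_trivialZ; apply: radial_low.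
  have {}it : (i : nat) <> p.-1 by move=> E; case/eqP: it; apply: val_inj.
  have {}im : (i : nat) <> p.-1./2 by move=> E; case/eqP: im; apply: val_inj.
  have ip := ltn_ord i.
  have [ltip|geip] := ltnP (i * 2) p; first by rewrite modn_small //; lia.
  by rewrite -(subnK geip) modnDr modn_small; lia.
set s := \sum_(i < p | _) _.
have <- : (e * f) ^+ p.-1 - h ^+ p * h ^+ p.-2 - c ^+ p.-1./2 * h ^+ p.-1 = s.
  rewrite ef_expand (bigD1 top) //= (bigD1 mid) //= -/s.
  have -> : (p.-1 - p.-1./2 = p.-1./2)%N by lia.
  rewrite m2 subnn -exprD.
  have -> : (p.-1 * 2 = p + p.-2)%N by lia.
  ring.
have Ep (t : S) : t ^+ p = t * t ^+ p.-1 by rewrite -exprS prednK.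
by rewrite /radial_trivial; congr is_coboundary; rewrite exprMn !Ep; ring.
Qed.

(** * There is no other relation *)

Lemma Dh_iter_De n s :
  Dh (iter n De s) = iter n De (Dh s) + (2 * n)%:R * iter n De s.
Proof.
elim: n => [|n IHn]; first by rewrite muln0 mul0r addr0.
rewrite iterS Dh_e_comm IHn actD actMnat -iterS.
by rewrite !natrM -(natr1 n) /=; ring.
Qed.

(** If x acts on polynomials in h as y d/dh, its (p-1)-st iterate extracts the
coefficient of h^(p-1) over the constants h^p, times (p-1)! y^(p-1). *)
Lemma iter_top_h x y n : act x h = y -> act x y = 0 ->
  iter p.-1 (act x) (h ^+ n) =
  if (n %% p == p.-1)%N then h ^+ (n %/ p * p) * (p.-1`!%:R * y ^+ p.-1) else 0.
Proof.
move=> xh xy; have p_gt0 : (0 < p)%N by lia.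
have hp : h ^+ (n %/ p * p) = v (Zhp k p ^+ (n %/ p)).
  by rewrite rmorphXn /= -exprM mulnC.
rewrite {1}(divn_eq n p) exprD hp iter_act_invl ?(act_Z charkp) //.
rewrite (iter_act_exp _ _ xh xy).
case: eqP => [->|ne]; first by rewrite ffactnn subnn mulr1.
rewrite ffact_small ?mul0r ?mulr0 //; have := ltn_pmod n p_gt0; lia.
Qed.

(** Contracting a coboundary with the Hamiltonian derivations of e and f, up to
tangency to c, gives images of these derivations. *)
Lemma coboundary_radial A B : is_coboundary A 0 B ->
  exists G, h * A = De G /\ h * B = - Df G.
Proof.
move=> [be [bh [bf [-> C0 ->]]]].
exists (h * bh + 2 * e * bf + 2 * f * be).
have te := act_casimir_tangent be; have tf := act_casimir_tangent bf.
split; apply/eqP; rewrite -subr_eq0 !(actD, actM, act_natr, actsE); apply/eqP.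
  transitivity (- (2 * e * Df be + 2 * f * De be + h * Dh be)
      - 2 * e * (De bf - Df be - bh)); first by ring.
  by rewrite te -C0; ring.
transitivity (2 * e * Df bf + 2 * f * De bf + h * Dh bf
    - 2 * f * (De bf - Df be - bh)); first by ring.
by rewrite tf -C0; ring.
Qed.

(** In the expansion of (ef)^(p-1), the exponent 2i is congruent to p-1 modulo p
only for i = (p-1)/2. *)
Lemma iter_top_ef x y : act x h = y -> act x y = 0 ->
  iter p.-1 (act x) ((e * f) ^+ p.-1) =
  c ^+ p.-1./2 * (p.-1`!%:R * y ^+ p.-1).
Proof.
move=> xh xy; have p_odd := odd_p.
have mid_lt : (p.-1./2 < p)%N by lia.
rewrite ef_expand iter_act_sum (bigD1 (Ordinal mid_lt)) //=.
have cE n : act x (c ^+ n) = 0 by rewrite act_exp act_casimir mulr0.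
rewrite iter_act_invl // (iter_top_h _ xh xy) big1 => [|i im].
  have -> : (p.-1./2 * 2 = p.-1)%N by lia.
  rewrite modn_small ?eqxx ?divn_small ?mul0n ?expr0 ?mul1r ?addr0; try lia.
  by congr (c ^+ _ * _); lia.
rewrite iter_act_invl // (iter_top_h _ xh xy) ifF ?mulr0 //.
have {}im : (i : nat) <> p.-1./2 by move=> E; case/eqP: im; apply: val_inj.
have ip := ltn_ord i; apply/eqP.
have [ltip|geip] := ltnP (i * 2) p; first by rewrite modn_small //; lia.
by rewrite -(subnK geip) modnDr modn_small; lia.
Qed.

(** The exponent 2i+1 is congruent to p-1 modulo p only for i = p-1, where it is
p + (p-1). *)
Lemma iter_top_hef x y : act x h = y -> act x y = 0 ->
  iter p.-1 (act x) ((e * f) ^+ p.-1 * h) = h ^+ p * (p.-1`!%:R * y ^+ p.-1).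
Proof.
move=> xh xy; have p_odd := odd_p.
have top_lt : (p.-1 < p)%N by lia.
rewrite ef_expand mulr_suml iter_act_sum.
rewrite (bigD1 (Ordinal top_lt)) //=.
have cE n : act x (c ^+ n) = 0 by rewrite act_exp act_casimir mulr0.
rewrite -mulrA -exprSr iter_act_invl // (iter_top_h _ xh xy).
rewrite big1 => [|i im].
  have -> : (p.-1 * 2).+1 = (1 * p + p.-1)%N by lia.
  rewrite modnMDl divnMDl ?modn_small ?eqxx ?divn_small; try lia.
  by rewrite addn0 mul1n subnn mul1r addr0.
rewrite -mulrA -exprSr iter_act_invl // (iter_top_h _ xh xy).
rewrite ifF ?mulr0 //.
have {}im : (i : nat) <> p.-1 by move=> E; case/eqP: im; apply: val_inj.
have ip := ltn_ord i; apply/eqP.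
have [ltip|geip] := ltnP (i * 2).+1 p; first by rewrite modn_small //; lia.
by rewrite -(subnK geip) modnDr modn_small; lia.
Qed.

Lemma Zval_inj : injective v. Proof. exact: val_inj. Qed.

(** The equations eqE, eqF and eqT come from iterating De or Df p-1 times on
h A, h B and A respectively; multiplying first by e^(p-1) or f^(p-1) turns the
contribution of R_e or R_f into a power of ef. *)
Lemma coboundary_comb (a b d t : Z) :
    is_coboundary
      (v a * f ^+ p.-1 + v d * (e * h ^+ p.-2) + v t * (e * h ^+ p.-1)) 0
      (v b * e ^+ p.-1 + v d * (f * h ^+ p.-2) + v t * (f * h ^+ p.-1)) ->
  exists r : Z, [/\ a = r * Zep k p, b = r * Zfp k p, d = r * - Zhp k p
                  & t = r * - Zc k p ^+ p.-1./2].
Proof.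
have p_gt0 : (0 < p)%N by lia.
have Ep (s : S) : s ^+ p = s * s ^+ p.-1 by rewrite -exprS prednK.
have hp2 : h ^+ p.-1 = h * h ^+ p.-2 by rewrite -exprS prednK //; lia.
move=> cob; have [G [hA hB]] := coboundary_radial cob.
have n0 (y : S) : y != 0 -> p.-1`!%:R * y ^+ p.-1 != 0.
  by move=> y0; rewrite mulf_neq0 ?expf_neq0 // fact_neq0 //; lia.
have n2 : 2 != 0 :> S by rewrite (pchar_natr_neq0 pcharS).
have ye0 : De (- 2 * e) = 0 by rewrite mulNr actN actMnat De_e mulr0 oppr0.
have yf0 : Df (2 * f) = 0 by rewrite actMnat Df_f mulr0.
have ze0 : p.-1`!%:R * (- 2 * e) ^+ p.-1 != 0.
  by apply: n0; rewrite mulf_neq0 ?oppr_eq0 ?mpolyXU_neq0.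
have zf0 : p.-1`!%:R * (2 * f) ^+ p.-1 != 0.
  by apply: n0; rewrite mulf_neq0 ?mpolyXU_neq0.
have topE n := iter_top_h n De_h ye0.
have topF n := iter_top_h n Df_h yf0.
have expE n : De (e ^+ n) = 0 by rewrite act_exp De_e mulr0.
have expF n : Df (f ^+ n) = 0 by rewrite act_exp Df_f mulr0.
have invl (x : sl2 k) n (z u : S) : act x z = 0 ->
    iter n (act x) (z * u) = z * iter n (act x) u.
  exact: iter_act_invl.
have topp : (p.-1 %% p == p.-1)%N by rewrite modn_small //; lia.
have topq : (p %% p == p.-1)%N = false by rewrite modnn; apply/eqP; lia.
have topr : (p.-2 %% p == p.-1)%N = false.
  by rewrite modn_small //; [apply/eqP|]; lia.
have divp : (p.-1 %/ p = 0)%N by rewrite divn_small //; lia.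
have eqE : v a * h ^+ p + v d * e ^+ p = 0.
  apply: (mulIf ze0); rewrite mul0r.
  have E : e ^+ p.-1 * (h * (v a * f ^+ p.-1 + v d * (e * h ^+ p.-2)
      + v t * (e * h ^+ p.-1))) = v a * ((e * f) ^+ p.-1 * h)
      + v d * (e ^+ p * h ^+ p.-1) + v t * (e ^+ p * h ^+ p).
    by rewrite !Ep hp2 exprMn; ring.
  have := congr1 (iter p.-1 De) E.
  rewrite hA (invl _ _ (e ^+ _)) // -iterSr prednK // iter_De_p // mulr0.
  rewrite !iter_actD (invl _ _ (v a)) ?(invl _ _ (v d)) ?(invl _ _ (v t))
    ?(act_Z charkp) //.
  rewrite !(invl _ _ (_ ^+ p) (h ^+ _)) ?expE //.
  rewrite (iter_top_hef De_h ye0) !topE topp topq divp mul0n expr0 !mulr0.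
  by rewrite mul1r addr0 => ->; ring.
have eqF : v b * h ^+ p + v d * f ^+ p = 0.
  apply: (mulIf zf0); rewrite mul0r.
  have E : f ^+ p.-1 * (h * (v b * e ^+ p.-1 + v d * (f * h ^+ p.-2)
      + v t * (f * h ^+ p.-1))) = v b * ((e * f) ^+ p.-1 * h)
      + v d * (f ^+ p * h ^+ p.-1) + v t * (f ^+ p * h ^+ p).
    by rewrite !Ep hp2 exprMn; ring.
  have := congr1 (iter p.-1 Df) E.
  rewrite hB (invl _ _ (f ^+ _)) // iter_actN -iterSr prednK // iter_Df_p //.
  rewrite oppr0 mulr0.
  rewrite !iter_actD (invl _ _ (v b)) ?(invl _ _ (v d)) ?(invl _ _ (v t))
    ?(act_Z charkp) //.
  rewrite !(invl _ _ (_ ^+ p) (h ^+ _)) ?expF //.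
  rewrite (iter_top_hef Df_h yf0) !topF topp topq divp mul0n expr0 !mulr0.
  by rewrite mul1r addr0 => ->; ring.
have eqT : v a * c ^+ p.-1./2 + v t * e ^+ p = 0.
  apply: (mulIf ze0); rewrite mul0r.
  (* The weight of De^(p-1) A is 2 + 2 (p-1) = 0, but A = De bh - (Dh - 2) be
     shows that De^(p-1) A lies in the image of Dh. *)
  have itA : iter p.-1 De (v a * f ^+ p.-1 + v d * (e * h ^+ p.-2)
      + v t * (e * h ^+ p.-1)) = 0.
    case: cob => be [bh [bf [AE _ _]]].
    set A := _ + _ + _ in AE *.
    have Aw : Dh A = 2 * A.
      rewrite /A !(actD, actM) !act_exp !(act_Z charkp) !actsE.
      by rewrite natr_pred_p expr_pred; ring.
    have two_p : (2 * p.-1)%:R = - 2 :> S.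
      by rewrite natrM natr_pred_p mulrN1.
    have Xw : Dh (iter p.-1 De A) = 0.
      rewrite Dh_iter_De Aw two_p iter_act_invl ?act_natr //; ring.
    have XE : iter p.-1 De A = - Dh (iter p.-1 De be).
      rewrite AE (iter_actD _ _ (De bh - _)) (iter_actD _ _ (De bh)) iter_actN.
      rewrite -iterSr prednK // iter_De_p // iter_act_invl ?act_natr //.
      by rewrite Dh_iter_De two_p; ring.
    by rewrite XE Dh_semisimple ?oppr0 //; apply: oppr_inj;
      rewrite -actN -XE Xw oppr0.
  have E : e ^+ p.-1 * (v a * f ^+ p.-1 + v d * (e * h ^+ p.-2)
      + v t * (e * h ^+ p.-1)) = v a * (e * f) ^+ p.-1
      + v d * (e ^+ p * h ^+ p.-2) + v t * (e ^+ p * h ^+ p.-1).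
    by rewrite !Ep exprMn; ring.
  have := congr1 (iter p.-1 De) E.
  rewrite (invl _ _ (e ^+ _)) // itA mulr0.
  rewrite !iter_actD (invl _ _ (v a)) ?(invl _ _ (v d)) ?(invl _ _ (v t))
    ?(act_Z charkp) //.
  rewrite !(invl _ _ (_ ^+ p) (h ^+ _)) ?expE //.
  rewrite (iter_top_ef De_h ye0) !topE topp topr divp mul0n expr0 !mulr0.
  by rewrite mul1r addr0 => ->; ring.
have [r ar] : exists r, v a = e ^+ p * r.
  apply: (@mpolyX_exp_gauss 0 1 p p (- v d)) => //.
  by apply/eqP; rewrite -subr_eq0; apply/eqP; rewrite -[RHS]oppr0 -eqE; ring.
have e0 : e ^+ p != 0 by rewrite expf_neq0 ?mpolyXU_neq0.
have h0 : h ^+ p != 0 by rewrite expf_neq0 ?mpolyXU_neq0.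
have rinv x : act x r = 0.
  apply: (mulfI e0); rewrite mulr0 -(act_Z charkp x a) ar actM.
  by rewrite (act_Z charkp x (Zep k p)) mul0r add0r.
have [z rz] := invariant_Z (rinv _) (rinv _).
have dz : v d = - h ^+ p * r.
  apply: (mulfI e0); apply/eqP; rewrite -subr_eq0 -eqE ar; apply/eqP; ring.
exists z; split; apply: Zval_inj; rewrite !(rmorphM, rmorphN, rmorphXn) /= -rz.
- by rewrite ar mulrC.
- apply: (mulfI h0); apply/eqP; rewrite -subr_eq0 -eqF dz; apply/eqP; ring.
- by rewrite dz; ring.
apply: (mulfI e0); apply/eqP; rewrite -subr_eq0 -eqT ar; apply/eqP; ring.
Qed.

End Char.

End Sl2Cohomology.

(** * Ext^2 *)

Lemma Ext2_class_coboundary (k : fieldType) (p : nat) (charkp : p \in [pchar k])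
    (a b : cocycle2 k) (A C B : {mpoly k[3]}) :
    cocycle2_val a = (A, C, B) + cocycle2_val b ->
  Ext2_class charkp a = Ext2_class charkp b <-> is_coboundary A C B.
Proof.
move=> E; rewrite Ext2_class_eqP is_coboundaryP /coboundary_pred.
have -> : (A, C, B) = cocycle2_val (a - b).
  by rewrite [RHS](raddfB val) /= E addrK.
by split=> [/asboolP|?] //; apply/asboolP.
Qed.

Theorem theorem5p7 (k : fieldType) (p : nat) (charkp : p \in [pchar k])
    (p_gt2 : (2 < p)%N) :
  let phi (v : 'rV[Zalg k p]_4) : Ext2 charkp :=
    v 0 0 *: Ext2_class charkp (cocycle_Re k p)
    + v 0 1 *: Ext2_class charkp (cocycle_Rf k p)
    + v 0 2 *: Ext2_class charkp (cocycle_Rh k p)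
    + v 0 3 *: Ext2_class charkp (cocycle_T k p) in
  let rel : 'rV[Zalg k p]_4 :=
    \row_(i < 4)
      [:: Zep k p; Zfp k p; - Zhp k p; - Zc k p ^+ (p.-1)./2]`_i in
  (forall x : Ext2 charkp, exists v, phi v = x)
  /\ (forall v, phi v = 0 <-> exists z : Zalg k p, v = z *: rel).
Proof.
move=> phi rel.
pose comb (v : 'rV[Zalg k p]_4) : cocycle2 k :=
  scale_cocycle charkp (v 0 0) (cocycle_Re k p)
  + scale_cocycle charkp (v 0 1) (cocycle_Rf k p)
  + scale_cocycle charkp (v 0 2) (cocycle_Rh k p)
  + scale_cocycle charkp (v 0 3) (cocycle_T k p).
have phiE v : phi v = Ext2_class charkp (comb v).
  by rewrite /phi /comb !Ext2_classD !Ext2_classZ.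
pose e := Se k; pose h := Sh k; pose f := Sf k.
pose A (v : 'rV[Zalg k p]_4) :=
  Zval (v 0 0) * f ^+ p.-1 + Zval (v 0 2) * (e * h ^+ p.-2)
  + Zval (v 0 3) * (e * h ^+ p.-1).
pose B (v : 'rV[Zalg k p]_4) :=
  Zval (v 0 1) * e ^+ p.-1 + Zval (v 0 2) * (f * h ^+ p.-2)
  + Zval (v 0 3) * (f * h ^+ p.-1).
have combE (v : 'rV[Zalg k p]_4) : cocycle2_val (comb v) = (A v, 0, B v).
  have valD (a b : cocycle2 k) :
      cocycle2_val (a + b) = cocycle2_val a + cocycle2_val b.
    exact: (raddfD (val : cocycle2 k -> _)).
  rewrite /comb !valD /= /scale_cochain /A /B /=.
  by congr (_, _, _) => /=; rewrite -/e -/h -/f; ring.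
have phi0 v : phi v = 0 <-> is_coboundary (A v) 0 (B v).
  have -> : 0 = Ext2_class charkp 0 by rewrite /Ext2_class raddf0.
  by rewrite phiE; apply: Ext2_class_coboundary; rewrite combE /= addr0.
split=> [x|v].
  have [a <-] := Ext2_class_surj x.
  have [[[Aa Ca] Ba] aP] : exists t, cocycle2_val a = t.
    by exists (cocycle2_val a).
  have cocyc : act (sl2_e k) Ba + act (sl2_f k) Aa = act (sl2_h k) Ca.
    by move: (valP a) => /eqP /=; rewrite aP.
  have [r1 [r2 [r3 [r4 cob]]]] := cocycle_generated charkp p_gt2 cocyc.
  pose v : 'rV[Zalg k p]_4 := \row_(i < 4) [:: r1; r2; r3; r4]`_i.
  exists v; rewrite phiE; apply/esym.
  apply/(@Ext2_class_coboundary _ _ _ _ _ (Aa - A v) Ca (Ba - B v)).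
    by rewrite combE aP; congr (_, _, _); rewrite /= ?addr0 ?subrK.
  by rewrite /A /B !mxE.
rewrite phi0; split=> [/(coboundary_comb charkp p_gt2) [r [v0 v1 v2 v3]]|[z ->]].
  exists r; apply/rowP => i; rewrite !mxE.
  by case: i => [[|[|[|[|]]]]] //= lti; rewrite -?v0 -?v1 -?v2 -?v3;
    congr (v _ _); apply: val_inj.
rewrite /A /B !mxE /=.
have := is_coboundaryM (act_Z charkp _ z) (act_Z charkp _ z) (act_Z charkp _ z)
  (relation_coboundary charkp p_gt2).
rewrite mulr0; congr is_coboundary;
  rewrite !(rmorphM, rmorphN, rmorphXn) /= -/e -/h -/f; ring.
Qed.
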